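(* Let $\xi,\phi : I \to \mathbb{Q}_v$ be unit speed semi-real quaternionic curves with arc-length parameters $s$ and $s^*$ respectively. If $\phi$ is a quaternionic involute of $\xi$, then $d_{\mathbb{L}}(\xi(s),\phi(s^* )) = |c-s|$, where $c$ is a real number (a constant independent of $s$) and $\phi(s^* )$ is the point of $\phi$ corresponding to $\xi(s)$.
   Context: $\mathbb{Q}_v$ denotes the space of semi-real quaternions $q=q_1\mathbf e_1+q_2\mathbf e_2+q_3\mathbf e_3+q_4$, identified with the four-dimensional semi-Euclidean space $\mathbb{E}_2^4$ of index 2. It carries the symmetric non-degenerate real bilinear form $h(p,q)=p_1q_1+p_2q_2-p_3q_3-p_4q_4$ and the norm $N(q)=\sqrt{|h(q,q)|}=\sqrt{|q_1^2+q_2^2-q_3^2-q_4^2|}$; $d_{\mathbb L}(p,q)=N(p-q)$. A semi-real quaternionic curve is a smooth curve $\xi:I\subset\mathbb{R}\to\mathbb{Q}_v$; it is unit speed (parametrized by arc length) if its tangent $T_\xi=\xi'$ satisfies $N(T_\xi)=1$, and then $h(T_\xi,T_\xi)=\varepsilon_{T_\xi}\in\{\pm1\}$. Two curves $\phi$ (parameter $s^*$) and $\xi$ (parameter $s$), with a correspondence $s\mapsto s^*(s)$ between their points, are called semi-real quaternionic involute-evolute curves, with $\phi$ the involute of $\xi$, if $h(T_\phi(s^* ),T_\xi(s))=0$ at corresponding points, where the point $\phi(s^* )$ lies on the tangent line of $\xi$ at $\xi(s)$, i.e. $\phi(s^* )=\xi(s)+\lambda(s)T_\xi(s)$ for a smooth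 real function $\lambda$. *)

(* Defs.v *)
From HB Require Import structures.
From mathcomp Require Import all_boot all_order all_algebra.
From mathcomp Require Import all_classical all_reals all_analysis.

Set Implicit Arguments.
Unset Strict Implicit.
Unset Printing Implicit Defensive.

Import Order.TTheory GRing.Theory Num.Theory.
Import numFieldNormedType.Exports.
Local Open Scope classical_set_scope.
Local Open Scope ring_scope.

(* Semi-real quaternions q1 e1 + q2 e2 + q3 e3 + q4, as the underlying
   four-dimensional semi-Euclidean space: the coordinates q1, q2, q3, q4 are
   q 0 0, q 0 1, q 0 2, q 0 3.  The quaternion product is not used. The
   canonical norm of 'rV_4 (the sup norm) only serves to define derivatives;
   it is unrelated to the indefinite Nv below. *)
Definition Qv (R : realType) : normedModType R := 'rV[R]_4.

Definition hform (R : realType) (p q : Qv R) : R :=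
  p 0 0 * q 0 0 + p 0 1 * q 0 1 - p 0 2 * q 0 2 - p 0 3 * q 0 3.

Definition Nv (R : realType) (q : Qv R) : R := Num.sqrt `|hform q q|.

Definition dL (R : realType) (p q : Qv R) : R := Nv (p - q).

(* Curves are total functions of which only the values on the interval I
   matter. As I need not be open, smoothness on I is smoothness on some open
   set containing I. *)
Definition smooth_on (R : realType) (V : normedModType R) (I : set R)
    (f : R -> V) : Prop :=
  exists U : set R, [/\ open U, I `<=` U &
    forall (n : nat) (x : R), U x -> derivable (derive1n n f) x 1].

Definition tangent (R : realType) (xi : R -> Qv R) : R -> Qv R := derive1 xi.

Definition unit_speed_curve (R : realType) (I : set R) (xi : R -> Qv R) : Prop :=
  smooth_on I xi /\ (forall s, I s -> Nv (tangent xi s) = 1).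

(* phi, defined on J, is an involute of xi, defined on I, under the
   correspondence s |-> sstar s between their points. No regularity is required
   of sstar, which is an arbitrary map from I to J. *)
Definition is_involute (R : realType) (I J : set R) (phi xi : R -> Qv R)
    (sstar : R -> R) : Prop :=
  [/\ forall s, I s -> J (sstar s),
      exists lambda : R -> R, smooth_on I lambda /\
        (forall s, I s -> phi (sstar s) = xi s + lambda s *: tangent xi s)
    & forall s, I s -> hform (tangent phi (sstar s)) (tangent xi s) = 0].

(* Main.v *)
(* Differentiating phi (sstar s) = xi s + lambda s *: T s would give
   (1 + lambda' s) h(T, T) = 0 if sstar were differentiable, but sstar is
   arbitrary. Instead, suppose 1 + lambda' is nonzero at some interior point,
   hence on a whole open interval. There psi := xi + lambda T has
   h(psi' s, T s) != 0 whereas h(phi' (sstar s), T s) = 0, so psi' s and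
   phi' (sstar s) are linearly independent and (s, sstar s) is an isolated
   point of {(x, y) | psi x = phi y}. The graph of sstar over that interval is
   thus a discrete subset of the plane, hence countable, which is absurd. So
   lambda' = -1, lambda s = c - s, and d(xi s, phi (sstar s)) = |lambda s|. *)
Require Import Defs.
From HB Require Import structures.
From mathcomp Require Import all_boot all_order all_algebra.
From mathcomp Require Import all_classical all_reals all_analysis.
From mathcomp Require Import ring lra.

Import Order.TTheory GRing.Theory Num.Theory.
Import numFieldNormedType.Exports.
Local Open Scope classical_set_scope.
Local Open Scope ring_scope.

(** * Isolated points of graphs, countability, and functions of modulus one *)

Section graph.
Context {R : realType}.
Implicit Types (s t : R).

(* By Caratheodory, each difference is a continuous slope times the increment;
   eliminating y - t leaves (x - s) times a function of (x, y) which is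
   continuous at (s, t) and takes there the Jacobian as its value. *)
Lemma isolated_common_value (p q u v : R -> R) (p' q' u' v' s t : R) :
  is_derive s 1 p p' -> is_derive s 1 q q' ->
  is_derive t 1 u u' -> is_derive t 1 v v' ->
  q' * u' - v' * p' != 0 ->
  exists2 d : R, 0 < d & forall x y : R,
    `|x - s| < d -> `|y - t| < d ->
    p x - p s = u y - u t -> q x - q s = v y - v t -> x = s.
Proof.
move=> /is_derive1_caratheodory[P [pE Pc <-]].
move=> /is_derive1_caratheodory[Q [qE Qc <-]].
move=> /is_derive1_caratheodory[U [uE Uc <-]].
move=> /is_derive1_caratheodory[V [vE Vc <-]] J0.
have Jc : (Q z.1 * U z.2 - V z.2 * P z.1) @[z --> (s, t)] -->
    Q s * U t - V t * P s.
  have F := @cvg_fst _ _ (nbhs s) (nbhs t) _.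
  have S := @cvg_snd _ _ (nbhs s) (nbhs t) _.
  by apply: cvgB; apply: cvgM; apply: cvg_comp; [exact: F|exact: Qc|exact: S
    |exact: Uc|exact: S|exact: Vc|exact: F|exact: Pc].
have : nbhs (s, t) [set z | Q z.1 * U z.2 - V z.2 * P z.1 != 0].
  exact: cvgr_neq0 Jc J0.
move=> /nbhs_ballP[d /= d0 near0].
exists d => // x y xs yt pu qv.
have /= := near0 (x, y).
have dist : ball (s, t) d (x, y) by split; rewrite /ball/= distrC.
move=> /(_ dist) Jxy; apply: subr0_eq.
apply: (mulfI Jxy); rewrite mulr0.
rewrite qE vE in qv; rewrite pE uE in pu.
have -> : (Q x * U y - V y * P x) * (x - s) =
  (Q x * (x - s)) * U y - V y * (P x * (x - s)) by ring.
by rewrite qv pu; ring.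
Qed.

(** Points of the graph are encoded by integers. With [n s] larger than the inverse of the isolation
    radius at [s], two points with the same [n] and the same floors lie in one grid square of side
    [1 / n s], so isolation makes them equal. *)
Lemma countable_discrete_graph (A : set R) (f : R -> R) :
  (forall s, A s -> exists2 d : R, 0 < d & forall x, A x ->
    `|x - s| < d -> `|f x - f s| < d -> x = s) ->
  countable A.
Proof.
move=> isoA.
have /choice[n nP] s : exists n : nat, A s -> forall x, A x ->
    `|n%:R * x - n%:R * s| < 1 -> `|n%:R * f x - n%:R * f s| < 1 -> x = s.
  have [As|nAs] := pselect (A s); last by exists 0%N => /nAs.
  have [d d0 iso] := isoA s As.
  have [n nd] : exists n : nat, d^-1 < n%:R.
    by exists (Num.bound d^-1); apply/archi_boundP/ltW; rewrite invr_gt0.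
  exists n => _ x Ax.
  have n0 : 0 < n%:R :> R by rewrite (lt_trans _ nd) ?invr_gt0.
  have nd1 : n%:R^-1 < d by rewrite -(invrK d) ltf_pV2 ?posrE ?invr_gt0.
  by rewrite -!mulrBr !normrM (gtr0_norm n0) -!ltr_pdivlMl// !mulr1 =>
    /lt_trans/(_ nd1) xs /lt_trans/(_ nd1); exact: iso.
apply/countable_injP.
exists (fun s => pickle (n s, Num.floor ((n s)%:R * s),
  Num.floor ((n s)%:R * f s))).
have close (a b : R) : Num.floor a = Num.floor b -> `|a - b| < 1.
  move=> ab; have := floor_itv a; have := floor_itv b.
  rewrite -ab intrD ltr_norml; lra.
move=> x s /set_mem Ax /set_mem As /(pcan_inj pickleK)[nxs + +].
by rewrite nxs => /close ? /close ?; exact: (nP s).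
Qed.

(** A countable set has Lebesgue measure 0, while the interval has measure [b - a > 0]. *)
Lemma uncountable_itv_oo (a b : R) : a < b -> ~ countable `]a, b[.
Proof.
move=> ab /countable_lebesgue_measure0.
rewrite lebesgue_measure_itv/= lte_fin ab -EFinB => -[] /eqP.
by rewrite subr_eq0 gt_eqF.
Qed.

(** Near [s] the square of [f] is 1, so [2 * f s * f' = 0] with [f s] nonzero. Squaring avoids
    having to show that the sign of [f] is locally constant. *)
Lemma norm1_derive_eq0 (f : R -> R) (f' a b s : R) :
  s \in `]a, b[ -> {in `]a, b[, forall x, `|f x| = 1} ->
  is_derive s 1 f f' -> f' = 0.
Proof.
move=> sab f1 df.
have : 'D_1 (f * f) s = 'D_1 (cst (1 : R)) s.
  apply: near_eq_derive; near=> x.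
  have xab : x \in `]a, b[ by near: x; exact: near_in_itvoo.
  by rewrite /cst fctE -[LHS]expr2 -real_normK ?num_real// f1// expr1n.
rewrite derive_cst deriveM// !derive_val.
have fs : f s != 0 by rewrite -normr_gt0 f1.
move=> /eqP; rewrite -mulr2n mulrn_eq0/= scaler_eq0 (negbTE fs).
by move/eqP.
Unshelve. all: by end_near. Qed.

End graph.

(** * The bilinear form: algebra and product rule *)

Section hform.
Context {R : realType}.
Implicit Types (p q : Qv R).

Lemma hformZl (k : R) p q : hform (k *: p) q = k * hform p q.
Proof. by rewrite /hform !mxE; ring. Qed.

Lemma hformDl p1 p2 q : hform (p1 + p2) q = hform p1 q + hform p2 q.
Proof. by rewrite /hform !mxE; ring. Qed.

Lemma hformC p q : hform p q = hform q p.
Proof. by rewrite /hform; ring. Qed.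

Lemma NvZ (k : R) q : Nv (k *: q) = `|k| * Nv q.
Proof.
rewrite /Nv hformZl hformC hformZl mulrA -expr2 normrM sqrtrM//.
by rewrite normrX sqrtr_sqr normr_id.
Qed.

Lemma is_derive_coord (c : R -> Qv R) (s : R) (j : 'I_4) :
  derivable c s 1 -> is_derive s 1 (fun x => c x 0 j) (tangent c s 0 j).
Proof.
move=> dc; rewrite /tangent derive1E derive_mx// mxE; apply: derivableP.
by move/derivable_mxP : dc; exact.
Qed.

Lemma is_derive_hform (c1 c2 : R -> Qv R) (s : R) :
  derivable c1 s 1 -> derivable c2 s 1 ->
  is_derive s 1 (fun x => hform (c1 x) (c2 x))
    (hform (tangent c1 s) (c2 s) + hform (c1 s) (tangent c2 s)).
Proof.
move=> dc1 dc2.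
have d1 := is_derive_coord _ _ _ dc1; have d2 := is_derive_coord _ _ _ dc2.
have dM j := is_deriveM (d1 j) (d2 j).
have := is_deriveB (is_deriveB (is_deriveD (dM 0) (dM 1)) (dM 2)) (dM 3).
by move/is_derive_eq; apply; rewrite /hform /GRing.scale/=; ring.
Qed.

End hform.

Lemma smooth_on_derivable (R : realType) (I : set R) (V : normedModType R)
    (f : R -> V) (s : R) n :
  smooth_on I f -> I s -> derivable (derive1n n f) s 1.
Proof. by move=> [U [_ IU df]] /IU; exact: df. Qed.

(** * The displacement [lambda] along the tangent has slope -1 *)

Section involute.
Context {R : realType} (I : set R) (xi phi : R -> Qv R) (sstar lambda : R -> R).

Context (intI : is_interval I).
Context (xi_unit : unit_speed_curve I xi).
Context (phi_unit : unit_speed_curve I phi).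
Context (sstarI : forall s, I s -> I (sstar s)).
Context (lambda_smooth : smooth_on I lambda).
Context (phiE : forall s, I s ->
  phi (sstar s) = xi s + lambda s *: tangent xi s).
Context (orth : forall s, I s ->
  hform (tangent phi (sstar s)) (tangent xi s) = 0).

Let itv_oo_sub a b x : I a -> I b -> x \in `]a, b[ -> I x.
Proof.
move=> Ia Ib; rewrite in_itv/= => /andP[? ?].
by apply: (intI a b) => //; rewrite !ltW.
Qed.

Let xi_derivable s : I s -> derivable xi s 1.
Proof. exact: (smooth_on_derivable _ _ _ _ _ 0 xi_unit.1). Qed.

Let tangent_derivable s : I s -> derivable (tangent xi) s 1.
Proof. exact: (smooth_on_derivable _ _ _ _ _ 1 xi_unit.1). Qed.

Let lambda_derivable s : I s -> derivable lambda s 1.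
Proof. exact: (smooth_on_derivable _ _ _ _ _ 0 lambda_smooth). Qed.

Lemma norm_hform_tangent (c : R -> Qv R) s : unit_speed_curve I c -> I s ->
  `|hform (tangent c s) (tangent c s)| = 1.
Proof.
move=> [_ c1] /c1; rewrite /Nv => h1.
by rewrite -[LHS]sqr_sqrtr// h1 expr1n.
Qed.

(** With T the tangent, h(T, T) has modulus 1, so its derivative 2 h(T', T) vanishes. The bounds [a]
    and [b] put [s] in the interior of [I], so that the modulus is 1 on a whole neighbourhood of
    [s]. *)
Lemma hform_acceleration_tangent (a b s : R) : I a -> I b -> s \in `]a, b[ ->
  hform (tangent (tangent xi) s) (tangent xi s) = 0.
Proof.
move=> Ia Ib sab.
have Iab x := itv_oo_sub a b x Ia Ib.
have Td := tangent_derivable s (Iab s sab).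
have : {in `]a, b[, forall x, `|hform (tangent xi x) (tangent xi x)| = 1 }.
  by move=> x /Iab; exact: norm_hform_tangent.
move=> /(norm1_derive_eq0 _ _ _ _ _ sab)/(_ (is_derive_hform _ _ _ Td Td)).
by rewrite [X in _ + X]hformC; lra.
Qed.

(** The vector equation psi x = phi y, with psi = xi + lambda T, is reduced to two scalar ones to
    which [isolated_common_value] applies: its coordinate [j], and its pairing with the tangent
    vector frozen at [s]. *)
Lemma isolated_involute_point (a b s : R) : I a -> I b -> s \in `]a, b[ ->
  1 + derive1 lambda s != 0 ->
  exists2 d : R, 0 < d & forall x, I x ->
    `|x - s| < d -> `|sstar x - sstar s| < d -> x = s.
Proof.
move=> Ia Ib sab lam.
have Is := itv_oo_sub a b s Ia Ib sab.
have It := sstarI s Is.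
have acc := hform_acceleration_tangent a b s Ia Ib sab.
set T := tangent xi s.
have TT : hform T T != 0 by rewrite -normr_gt0 (norm_hform_tangent xi).
(* A null tangent of [phi] would contradict unit speed; [j] is chosen to make the derivative of the
   scalar function [phi _ 0 j] nonzero. *)
have [j phij] : exists j, tangent phi (sstar s) 0 j != 0.
  apply/existsP; apply: contra_neqT (oner_neq0 R) => /existsPn phi0.
  rewrite -(norm_hform_tangent phi (sstar s))// /hform.
  have z i : tangent phi (sstar s) 0 i = 0 by have /negPn/eqP := phi0 i.
  by rewrite !z !mul0r addr0 !subr0 normr0.
have xid := xi_derivable s Is; have Td := tangent_derivable s Is.
have dl : is_derive s 1 lambda (derive1 lambda s).
  by rewrite derive1E; apply/derivableP/lambda_derivable.
have phid := smooth_on_derivable _ _ _ _ _ 0 phi_unit.1 It.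
have dp : is_derive s 1 (fun x => xi x 0 j + lambda x * tangent xi x 0 j) _ :=
  is_deriveD (is_derive_coord xi s j xid)
             (is_deriveM dl (is_derive_coord _ s j Td)).
have cd : derivable (cst T) s 1 by exact: derivable_cst.
have cd' : derivable (cst T) (sstar s) 1 by exact: derivable_cst.
have dq : is_derive s 1
    (fun x => hform (xi x) T + lambda x * hform (tangent xi x) T) _ :=
  is_deriveD (is_derive_hform _ _ _ xid cd)
             (is_deriveM dl (is_derive_hform _ _ _ Td cd)).
have du := is_derive_coord phi _ j phid.
have dv := is_derive_hform _ _ _ phid cd'.
have c0 (t : R) : tangent (cst T) t = 0 by rewrite /tangent derive1E derive_cst.
have h0 p : hform p 0 = 0 by rewrite /hform !mxE !mulr0 addr0 !subr0.
have := isolated_common_value _ _ _ _ _ _ _ _ _ _ dp dq du dv.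
case=> [|d d0 iso].
  (* Since h(phi', T) = 0 and h(T', T) = 0, the Jacobian reduces to (1 + lambda') h(T, T) times
     coordinate [j] of phi'. *)
  rewrite !c0 !h0 !addr0 /= -/T acc orth// mul0r subr0 mulf_neq0//.
  rewrite /GRing.scale/= mulr0 add0r -[X in X + _]mul1r
    [X in _ + X]mulrC -mulrDl.
  by rewrite mulf_neq0.
exists d => // x Ix xs ts.
apply: (iso x (sstar x)) => //=; rewrite !phiE//; first by rewrite !mxE.
by rewrite !hformDl !hformZl.
Qed.

Lemma derive1_lambda (a b s : R) : I a -> I b -> s \in `]a, b[ ->
  derive1 lambda s = -1.
Proof.
move=> Ia Ib sab; apply/eqP; rewrite -addr_eq0 addrC; apply/negPn/negP => lam.
have Is := itv_oo_sub a b s Ia Ib sab.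
(* Continuity of lambda' spreads 1 + lambda' != 0 from [s] to an interval around it, over which the
   graph of [sstar] is then discrete. *)
have lamc : 1 + derive1 lambda x @[x --> s] --> 1 + derive1 lambda s.
  apply: cvgD; first exact: cvg_cst.
  apply/differentiable_continuous/derivable1_diffP.
  exact: (smooth_on_derivable _ _ _ _ _ 1 lambda_smooth).
have : \forall x \near s, (x \in `]a, b[) /\ 1 + derive1 lambda x != 0.
  near=> x; split; first by near: x; exact: near_in_itvoo.
  by near: x; exact: cvgr_neq0 lamc lam.
move=> /nbhs_ballP[d /= d0 sd].
apply: (@uncountable_itv_oo _ (s - d) (s + d)); first lra.
rewrite -ball_itv; apply: (countable_discrete_graph _ sstar) => x xd.
have [xab lamx] := sd _ xd.
have [e e0 iso] := isolated_involute_point a b x Ia Ib xab lamx.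
by exists e => // y /sd[yab _]; apply: iso; exact: itv_oo_sub yab.
Unshelve. all: by end_near. Qed.

(** By the mean value theorem: [lambda + id] is continuous on the closed interval, and its
    derivative vanishes inside, where [derive1_lambda] applies. *)
Lemma lambdaD_cst (a b : R) : I a -> I b -> lambda a + a = lambda b + b.
Proof.
wlog ab : a b / a <= b.
  by move=> h Ia Ib; have [/h ->|/ltW/h ->] := leP a b.
move=> Ia Ib.
have Iab x : x \in `[a, b] -> I x by rewrite in_itv/=; exact: intI.
have ld x : I x -> is_derive x 1 (lambda + id) (derive1 lambda x + 1).
  move=> Ix; apply: is_deriveD; rewrite derive1E.
  exact/derivableP/lambda_derivable.
have [||c _] := @MVT_segment _ (lambda + id) (cst 0) a b ab.
- move=> x xab; have Ix : I x by apply/Iab/subset_itv_oo_cc.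
  by apply: is_derive_eq (ld x Ix) _; rewrite (derive1_lambda a b)// addrC subrr.
- by apply: derivable_within_continuous => x /Iab/ld[].
by rewrite /cst mul0r => /subr0_eq.
Qed.

End involute.

Theorem theorem3p2 (R : realType) (I : set R) (xi phi : R -> Qv R)
    (sstar : R -> R) :
  is_interval I ->
  unit_speed_curve I xi ->
  unit_speed_curve I phi ->
  is_involute I I phi xi sstar ->
  exists c : R, forall s : R, I s -> dL (xi s) (phi (sstar s)) = `|c - s|.
Proof.
move=> intI xi_unit phi_unit [sstarI [lambda [lambda_smooth phiE]] orth].
have cst a b := @lambdaD_cst _ I xi phi sstar lambda intI xi_unit phi_unit
  sstarI lambda_smooth phiE orth a b.
have [I0|/nonemptyPn I0] := pselect (I !=set0); last first.
  by exists 0 => s; rewrite I0.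
have [s0 Is0] := I0.
(* Constancy of [lambda s + s] gives [lambda s = c - s] for this value of c, and the distance is
   [|lambda s|] times the unit norm of the tangent. *)
exists (lambda s0 + s0) => s Is.
rewrite (cst s0 s)// addrK /dL phiE// opprD addNKr -scaleNr NvZ.
by rewrite (xi_unit.2 s Is) mulr1 normrN.
Qed.
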